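(* There is a computable finitely branching tree $S$ with exactly one infinite path (so $S$ is a type 2 tree) such that no computable tree classically isomorphic to $S$ has a computable nontrivial self-embedding.
   Context: A tree is a partial order $(T,\preceq)$ with a least element (the root) such that for every $n\in T$ the set $\{m\in T: m\preceq n\}$ is finite and linearly ordered; all trees are countable. A tree is computable if $T\subseteq\omega$ is computable and $\preceq$ is computable. It is finitely branching if every node has finitely many immediate successors. A path is an infinite maximal linearly ordered subset. An embedding between trees is an injective map $f$ with $n\preceq m$ iff $f(n)\preceq f(m)$; a self-embedding is nontrivial if it is not onto. A type 2 tree is one with no node $n$ such that $T(n)=\{m:n\preceq m\}$ is infinite while $T(m)$ is finite for all $m\succ n$, but having a path $P$ and a node on $P$ lying on no other path. *)

(* Defs.v *)
From mathcomp Require Import all_boot.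
From mathcomp Require Import boolp classical_sets functions cardinality.
From Stdlib Require Cantor.

Set Implicit Arguments.
Unset Strict Implicit.
Unset Printing Implicit Defensive.

Local Open Scope classical_set_scope.

(* Kleene's partial recursive functions. Every code denotes a unary partial
   function; several arguments are passed through Cantor's pairing. *)
Definition pair_nat (x y : nat) : nat := Cantor.to_nat (x, y).
Definition fst_nat (x : nat) : nat := (Cantor.of_nat x).1.
Definition snd_nat (x : nat) : nat := (Cantor.of_nat x).2.

Inductive code : Set :=
| CZero
| CSucc
| CFst
| CSnd
| CPair of code & code
| CComp of code & code
| CPrec of code & code
| CMu of code.

(* [eval c x y]: the computation of [c] on [x] converges to [y].
   - [CPrec f g] maps <a, 0> to f(a) and <a, k+1> to g(<a, <k, h(<a, k>)>>),
     where h is the function being defined.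
   - [CMu f] maps a to the least n such that f(<a, n>) = 0, where moreover
     f(<a, k>) must converge for all k < n. *)
Fixpoint eval (c : code) (x y : nat) : Prop :=
  match c with
  | CZero => y = 0
  | CSucc => y = x.+1
  | CFst => y = fst_nat x
  | CSnd => y = snd_nat x
  | CPair f g => exists u v, [/\ eval f x u, eval g x v & y = pair_nat u v]
  | CComp f g => exists2 z, eval g x z & eval f z y
  | CPrec f g =>
      (fix rec (n : nat) (r : nat) : Prop :=
         match n with
         | 0 => eval f (fst_nat x) r
         | k.+1 => exists2 z, rec k z &
             eval g (pair_nat (fst_nat x) (pair_nat k z)) r
         end) (snd_nat x) y
  | CMu f => eval f (pair_nat x y) 0 /\
      forall k, k < y -> exists w, eval f (pair_nat x k) w.+1
  end.

Definition computable_set (A : set nat) : Prop :=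
  exists c, forall n, (A n -> eval c n 1) /\ (~ A n -> eval c n 0).

Definition computable_rel (r : nat -> nat -> Prop) : Prop :=
  exists c, forall m n, (r m n -> eval c (pair_nat m n) 1) /\
                        (~ r m n -> eval c (pair_nat m n) 0).

(* The values of [f] outside [A] are irrelevant: a function with domain [A] is
   represented by any of its total extensions. *)
Definition computable_on (A : set nat) (f : nat -> nat) : Prop :=
  exists c, forall n, A n -> eval c n (f n).

(* A tree whose underlying set [nodes] is a subset of omega; [tle] is the
   order, as a subset of [nodes `*` nodes]. *)
Record tree := Tree {
  nodes : set nat;
  tle : nat -> nat -> Prop;
  tle_nodes : forall m n, tle m n -> nodes m /\ nodes n;
  tle_refl : forall n, nodes n -> tle n n;
  tle_anti : forall m n, tle m n -> tle n m -> m = n;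
  tle_trans : forall m n p, tle m n -> tle n p -> tle m p;
  tle_root : exists2 r, nodes r & forall n, nodes n -> tle r n;
  tle_below_finite : forall n, nodes n -> finite_set [set m | tle m n];
  tle_below_linear : forall n m1 m2, tle m1 n -> tle m2 n ->
    tle m1 m2 \/ tle m2 m1
}.

Definition tlt (T : tree) (m n : nat) : Prop := tle T m n /\ m <> n.

Definition computable_tree (T : tree) : Prop :=
  computable_set (nodes T) /\ computable_rel (tle T).

Definition imm_succ (T : tree) (n m : nat) : Prop :=
  tlt T n m /\ ~ exists k, tlt T n k /\ tlt T k m.

Definition finitely_branching (T : tree) : Prop :=
  forall n, nodes T n -> finite_set [set m | imm_succ T n m].

Definition is_chain (T : tree) (P : set nat) : Prop :=
  P `<=` nodes T /\ forall m n, P m -> P n -> tle T m n \/ tle T n m.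

Definition is_path (T : tree) (P : set nat) : Prop :=
  [/\ is_chain T P, infinite_set P &
      forall Q, is_chain T Q -> P `<=` Q -> Q = P].

Definition cone (T : tree) (n : nat) : set nat := [set m | tle T n m].

Definition type2 (T : tree) : Prop :=
  (~ exists n, [/\ nodes T n, infinite_set (cone T n) &
                   forall m, tlt T n m -> finite_set (cone T m)]) /\
  exists P, is_path T P /\
    exists2 n, P n & forall Q, is_path T Q -> Q n -> Q = P.

Definition embedding (T T' : tree) (f : nat -> nat) : Prop :=
  [/\ set_fun (nodes T) (nodes T') f, set_inj (nodes T) f &
      forall m n, nodes T m -> nodes T n -> (tle T m n <-> tle T' (f m) (f n))].

Definition isomorphic (T T' : tree) : Prop :=
  exists f, embedding T T' f /\ set_surj (nodes T) (nodes T') f.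

Definition nontrivial_self_embedding (T : tree) (f : nat -> nat) : Prop :=
  embedding T T f /\ ~ set_surj (nodes T) (nodes T) f.

(* Main.v *)
Require Import Defs.
From mathcomp Require Import all_boot.
From mathcomp Require Import boolp classical_sets functions cardinality.
From mathcomp Require Import zify.
From Stdlib Require Cantor.

(* The tree is given by a computable sequence [depth] with depth (s+1) <= depth s + 1:
   stage s adds the node s, whose parent is the latest node of smaller depth. If every
   depth is visited finitely often, the tree is finitely branching and its only path
   consists of the nodes that are never left. A nontrivial self-embedding f of a copy T
   moves the path strictly upwards, so iterating f on a fork (y, z) with y on the path
   produces forks at arbitrarily high levels, and the program "v <= f^m(y) and
   v <= f^m(z)", with m chosen large in terms of the index i of the program itself,
   enumerates the nodes up to the branching point of such a fork. Their number at stage s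
   is a nondecreasing guess l at the level of that point. The construction keeps the path
   node of level l unforked: whenever it is forked, requirement i makes the sequence
   return to a depth v <= l, so that everything above level v - 1 becomes a dead side
   branch and the new node of level l has a single child; then T cannot
   be isomorphic to the tree. The priority ordering is that v - 1 is not the
   current level of a requirement j < i; it makes every requirement act finitely
   often at each depth. All unguarded levels are forked, which provides the
   forks that f is iterated on. *)

Set Implicit Arguments.
Unset Strict Implicit.
Unset Printing Implicit Defensive.

(** * Closure properties of recursive functions *)

Lemma fst_pair x y : fst_nat (pair_nat x y) = x.
Proof. by rewrite /fst_nat /pair_nat Cantor.cancel_of_to. Qed.

Lemma snd_pair x y : snd_nat (pair_nat x y) = y.
Proof. by rewrite /snd_nat /pair_nat Cantor.cancel_of_to. Qed.

Lemma pair_fst_snd x : pair_nat (fst_nat x) (snd_nat x) = x.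
Proof.
by rewrite /fst_nat /snd_nat /pair_nat -surjective_pairing Cantor.cancel_to_of.
Qed.

Definition pairE := (fst_pair, snd_pair).

Definition recursive (f : nat -> nat) : Prop := exists c, forall x, eval c x (f x).

Lemma recursive_ext f g : f =1 g -> recursive f -> recursive g.
Proof. by move=> fg [c hc]; exists c => x; rewrite -fg. Qed.

Lemma recursive_comp f g :
  recursive f -> recursive g -> recursive (fun x => f (g x)).
Proof. by move=> [c hc] [e he]; exists (CComp c e) => x /=; exists (g x). Qed.

Lemma recursive_id : recursive (fun x => x).
Proof.
exists (CPair CFst CSnd) => x /=.
by exists (fst_nat x), (snd_nat x); rewrite pair_fst_snd.
Qed.

Lemma recursive_S f : recursive f -> recursive (fun x => (f x).+1).
Proof. by move=> hf; apply: recursive_comp hf; exists CSucc. Qed.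

Lemma recursive_fst f : recursive f -> recursive (fun x => fst_nat (f x)).
Proof. by move=> hf; apply: recursive_comp hf; exists CFst. Qed.

Lemma recursive_snd f : recursive f -> recursive (fun x => snd_nat (f x)).
Proof. by move=> hf; apply: recursive_comp hf; exists CSnd. Qed.

Lemma recursive_const n : recursive (fun=> n).
Proof. by elim: n => [|n /recursive_S //]; exists CZero. Qed.

Lemma recursive_pair f g :
  recursive f -> recursive g -> recursive (fun x => pair_nat (f x) (g x)).
Proof.
by move=> [c hc] [e he]; exists (CPair c e) => x /=; exists (f x), (g x).
Qed.

Lemma recursive_nat_rect (n a : nat -> nat) (g : nat -> nat -> nat -> nat) :
  recursive n -> recursive a ->
  recursive (fun w => g (fst_nat w) (fst_nat (snd_nat w)) (snd_nat (snd_nat w))) ->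
  recursive (fun x => nat_rect (fun=> nat) (a x) (g x) (n x)).
Proof.
move=> hn [ca ha] [cg hg].
pose F x := nat_rect (fun=> nat) (a (fst_nat x)) (g (fst_nat x)) (snd_nat x).
have hF : recursive F.
  exists (CPrec ca cg) => x; rewrite /F /=.
  elim: (snd_nat x) => [|k IH] /=; first exact: ha.
  eexists; first exact: IH.
  by have := hg (pair_nat (fst_nat x) (pair_nat k
    (nat_rect (fun=> nat) (a (fst_nat x)) (g (fst_nat x)) k))); rewrite !pairE.
apply: recursive_ext (recursive_comp hF (recursive_pair recursive_id hn)) => x.
by rewrite /F !pairE.
Qed.

(** Booleans count as 0 and 1, so a conditional is a recursion of at most one step. *)
Lemma recursive_if (b : nat -> bool) f g :
  recursive b -> recursive f -> recursive g ->
  recursive (fun x => if b x then f x else g x).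
Proof.
move=> hb hf hg.
apply: (@recursive_ext (fun x => nat_rect (fun=> nat) (g x) (fun _ _ => f x) (b x))).
  by move=> x; case: (b x).
apply: recursive_nat_rect => //.
by apply: recursive_comp hf _; apply: recursive_fst; exact: recursive_id.
Qed.

Lemma recursive_iter (n a g : nat -> nat) :
  recursive n -> recursive a -> recursive g ->
  recursive (fun x => iter (n x) g (a x)).
Proof.
move=> hn ha hg.
apply: (@recursive_ext (fun x => nat_rect (fun=> nat) (a x) (fun _ r => g r) (n x))).
  by move=> x; elim: (n x) => //= k ->.
apply: recursive_nat_rect => //; apply: (recursive_comp hg).
by do 2 apply: recursive_snd; exact: recursive_id.
Qed.

Lemma recursive_addn f g :
  recursive f -> recursive g -> recursive (fun x => f x + g x).
Proof.
move=> hf hg; apply: recursive_ext (recursive_iter hf hg (recursive_S recursive_id)).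
by move=> x; elim: (f x) => //= k ->.
Qed.

Lemma recursive_predn : recursive predn.
Proof.
apply: (@recursive_ext (fun x => nat_rect (fun=> nat) 0 (fun k _ => k) x)).
  by case.
apply: (recursive_nat_rect (n := id)); [exact: recursive_id|exact: recursive_const|].
by apply: recursive_fst; apply: recursive_snd; exact: recursive_id.
Qed.

Lemma recursive_subn f g :
  recursive f -> recursive g -> recursive (fun x => f x - g x).
Proof.
move=> hf hg; apply: recursive_ext (recursive_iter hg hf recursive_predn) => x.
by elim: (g x) => [|k /= ->]; rewrite ?subn0 // subnS.
Qed.

Lemma recursive_negb (b : nat -> bool) : recursive b -> recursive (fun x => ~~ b x).
Proof.
move=> hb; apply: recursive_ext (recursive_subn (recursive_const 1) hb).
by move=> x; case: (b x).
Qed.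

Lemma recursive_andb (b c : nat -> bool) :
  recursive b -> recursive c -> recursive (fun x => b x && c x).
Proof.
move=> hb hc; apply: recursive_ext (recursive_if hb hc (recursive_const 0)).
by move=> x; case: (b x).
Qed.

Lemma recursive_implyb (b c : nat -> bool) :
  recursive b -> recursive c -> recursive (fun x => b x ==> c x).
Proof.
move=> hb hc; apply: recursive_ext (recursive_if hb hc (recursive_const 1)).
by move=> x; case: (b x).
Qed.

Lemma recursive_eq0 f : recursive f -> recursive (fun x => f x == 0).
Proof.
move=> hf; apply: recursive_ext (recursive_subn (recursive_const 1) hf).
by move=> x; case: (f x).
Qed.

Lemma recursive_leq f g :
  recursive f -> recursive g -> recursive (fun x => f x <= g x).
Proof. by move=> hf hg; apply: recursive_eq0; exact: recursive_subn. Qed.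

Lemma recursive_eqn f g :
  recursive f -> recursive g -> recursive (fun x => f x == g x).
Proof.
move=> hf hg; have := recursive_andb (recursive_leq hf hg) (recursive_leq hg hf).
by apply: recursive_ext => x; rewrite eqn_leq.
Qed.

Lemma iota0S k : iota 0 k.+1 = iota 0 k ++ [:: k].
Proof. by rewrite -addn1 iotaD. Qed.

Section BoundedSearch.
Variables (P : nat -> nat -> bool) (n : nat -> nat).
Hypotheses (hP : recursive (fun w => P (fst_nat w) (snd_nat w)))
           (hn : recursive n).

Lemma recursive_count : recursive (fun x => count (P x) (iota 0 (n x))).
Proof.
apply: (@recursive_ext
  (fun x => nat_rect (fun=> nat) 0 (fun k r => P x k + r) (n x))).
  move=> x; elim: (n x) => // k IHk.
  by rewrite iota0S count_cat -IHk /= addn0 addnC.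
apply: recursive_nat_rect => //; first exact: recursive_const.
have hw := recursive_id; have hw2 := recursive_snd hw.
apply: recursive_addn; last exact: recursive_snd.
apply: recursive_ext (recursive_comp hP
  (recursive_pair (recursive_fst hw) (recursive_fst hw2))).
by move=> x; rewrite !pairE.
Qed.

Lemma recursive_has : recursive (fun x => has (P x) (iota 0 (n x))).
Proof.
apply: recursive_ext (recursive_leq (recursive_const 1) recursive_count) => x.
by rewrite has_count.
Qed.

Lemma recursive_all : recursive (fun x => all (P x) (iota 0 (n x))).
Proof.
apply: recursive_ext (recursive_eqn recursive_count hn) => x.
by rewrite all_count size_iota.
Qed.

Lemma recursive_find : recursive (fun x => find (P x) (iota 0 (n x))).
Proof.
(* An accumulator [r] equal to [k] means that no index below [k] satisfies [P x]. *)
apply: (@recursive_ext (fun x => nat_rect (fun=> nat) 0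
   (fun k r => if r == k then k + ~~ P x k else r) (n x))).
  move=> x; elim: (n x) => // k IHk.
  rewrite iota0S find_cat size_iota /= IHk.
  have := has_find (P x) (iota 0 k); rewrite size_iota.
  case: has => h; first by rewrite ltn_eqF.
  have -> : find (P x) (iota 0 k) == k.
    by have := find_size (P x) (iota 0 k); rewrite size_iota; lia.
  by case: (P x k).
apply: recursive_nat_rect => //; first exact: recursive_const.
have hw := recursive_id; have hw2 := recursive_snd hw.
have h1 := recursive_fst hw2; have h2 := recursive_snd hw2.
apply: recursive_if => //; first exact: recursive_eqn.
apply: recursive_addn => //; apply: recursive_negb.
apply: recursive_ext (recursive_comp hP (recursive_pair (recursive_fst hw) h1)).
by move=> x; rewrite !pairE.
Qed.

End BoundedSearch.

(* [simple apply] does not unfold [pair_nat] into a sum of successors. *)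
Ltac recursive :=
  repeat first
    [ assumption
    | simple apply recursive_id
    | simple apply recursive_const
    | simple apply recursive_pair
    | simple apply recursive_S
    | simple apply recursive_fst | simple apply recursive_snd
    | simple apply recursive_eqn | simple apply recursive_leq
    | simple apply recursive_if | simple apply recursive_negb
    | simple apply recursive_andb | simple apply recursive_implyb
    | simple apply recursive_addn | simple apply recursive_subn
    | simple apply recursive_count | simple apply recursive_has
    | simple apply recursive_all | simple apply recursive_find
    | progress cbv beta ].

(** * A universal stack machine *)

Definition cons_nat (a K : nat) : nat := (pair_nat a K).+1.
Definition instr (t a b : nat) : nat := pair_nat t (pair_nat a b).

Fixpoint enc (c : code) : nat :=
  match c with
  | CZero => instr 0 0 0
  | CSucc => instr 1 0 0
  | CFst => instr 2 0 0
  | CSnd => instr 3 0 0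
  | CPair f g => instr 4 (enc f) (enc g)
  | CComp f g => instr 5 (enc f) (enc g)
  | CPrec f g => instr 6 (enc f) (enc g)
  | CMu f => instr 7 (enc f) 0
  end.

(* One transition of a stack machine. A state is [pair_nat K v]: a stack [K] of
   instructions (the empty stack is 0) and a current value [v], to which the top
   instruction, with operation [t] and operands [a] and [b], is applied.
   Operations 0 to 7 run a program; 8 to 11 are the continuations of
   [CPair] (twice), [CPrec] and [CMu]. *)
Definition run_instr (t a b K v : nat) : nat :=
  let k := fst_nat (snd_nat b) in
  if t == 0 then pair_nat K 0
  else if t == 1 then pair_nat K v.+1
  else if t == 2 then pair_nat K (fst_nat v)
  else if t == 3 then pair_nat K (snd_nat v)
  else if t == 4 then pair_nat (cons_nat a (cons_nat (instr 8 b v) K)) v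
  else if t == 5 then pair_nat (cons_nat b (cons_nat a K)) v
  else if t == 6 then
    pair_nat (cons_nat a (cons_nat
      (instr 10 b (pair_nat (fst_nat v) (pair_nat 0 (snd_nat v)))) K)) (fst_nat v)
  else if t == 7 then
    pair_nat (cons_nat a (cons_nat (instr 11 a (pair_nat v 0)) K)) (pair_nat v 0)
  else if t == 8 then pair_nat (cons_nat a (cons_nat (instr 9 v 0) K)) b
  else if t == 9 then pair_nat K (pair_nat a v)
  else if t == 10 then
    if k == snd_nat (snd_nat b) then pair_nat K v
    else pair_nat (cons_nat a (cons_nat (instr 10 a
           (pair_nat (fst_nat b) (pair_nat k.+1 (snd_nat (snd_nat b))))) K))
           (pair_nat (fst_nat b) (pair_nat k v))
  else
    if v == 0 then pair_nat K (snd_nat b)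
    else pair_nat (cons_nat a (cons_nat
           (instr 11 a (pair_nat (fst_nat b) (snd_nat b).+1)) K))
           (pair_nat (fst_nat b) (snd_nat b).+1).

(** States with an empty stack are fixed, so a final value persists at all later stages. *)
Definition step (q : nat) : nat :=
  let I := fst_nat (fst_nat q).-1 in
  if fst_nat q == 0 then q
  else run_instr (fst_nat I) (fst_nat (snd_nat I)) (snd_nat (snd_nat I))
         (snd_nat (fst_nat q).-1) (snd_nat q).

Lemma recursive_step : recursive step.
Proof.
have hp f : recursive f -> recursive (fun x => (f x).-1).
  exact: (recursive_comp recursive_predn).
have [h0 h1] := (recursive_id, recursive_snd recursive_id).
have hI := recursive_fst (hp _ (recursive_fst h0)).
have hK := recursive_snd (hp _ (recursive_fst h0)).
rewrite /step /run_instr /cons_nat /instr; recursive.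
Qed.

Definition exec (q q' : nat) : Prop := exists n, iter n step q = q'.

Lemma exec_trans q q' q'' : exec q q' -> exec q' q'' -> exec q q''.
Proof. by move=> [m <-] [n <-]; exists (n + m); rewrite iterD. Qed.

Lemma exec_step q q' : exec (step q) q' -> exec q q'.
Proof. by apply: exec_trans; exists 1. Qed.

Lemma exec_refl q : exec q q. Proof. by exists 0. Qed.

Lemma step_instr t a b K v :
  step (pair_nat (cons_nat (instr t a b) K) v) = run_instr t a b K v.
Proof. by rewrite /step /cons_nat /instr !pairE. Qed.

(** The stack [K] is arbitrary so that the induction hypotheses apply to subprograms running on top
    of continuations. *)
Lemma exec_eval c x y K :
  eval c x y -> exec (pair_nat (cons_nat (enc c) K) x) (pair_nat K y).
Proof.
elim: c x y K => [||||f IHf g IHg|f IHf g IHg|f IHf g IHg|f IHf] x y K /=.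
- by move=> ->; apply: exec_step; rewrite step_instr /run_instr; apply: exec_refl.
- by move=> ->; apply: exec_step; rewrite step_instr /run_instr; apply: exec_refl.
- by move=> ->; apply: exec_step; rewrite step_instr /run_instr; apply: exec_refl.
- by move=> ->; apply: exec_step; rewrite step_instr /run_instr; apply: exec_refl.
- move=> [u [v [hu hv ->]]]; apply: exec_step; rewrite step_instr /run_instr /=.
  apply: exec_trans (IHf _ _ _ hu) _; apply: exec_step; rewrite step_instr /run_instr /=.
  apply: exec_trans (IHg _ _ _ hv) _; apply: exec_step; rewrite step_instr /run_instr /=.
  exact: exec_refl.
- move=> [z hz hy]; apply: exec_step; rewrite step_instr /run_instr /=.
  exact: exec_trans (IHg _ _ _ hz) (IHf _ _ _ hy).
- set rec := (X in X (snd_nat x) y -> _) => hy.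
  apply: exec_step; rewrite step_instr /run_instr /=.
  set a := fst_nat x; set n := snd_nat x.
  have loop k r : k <= n -> rec k r ->
      exec (pair_nat (cons_nat (enc f) (cons_nat
              (instr 10 (enc g) (pair_nat a (pair_nat 0 n))) K)) a)
           (pair_nat (cons_nat (instr 10 (enc g) (pair_nat a (pair_nat k n))) K) r).
    elim: k r => [|k IHk] r hk; first exact: IHf.
    move=> [z hz hr]; apply: exec_trans (IHk z (ltnW hk) hz) _.
    apply: exec_step; rewrite step_instr /run_instr /= !pairE ltn_eqF //; exact: IHg.
  apply: exec_trans (loop n y (leqnn n) hy) _.
  by apply: exec_step; rewrite step_instr /run_instr /= !pairE eqxx; exact: exec_refl.
- move=> [h0 hS]; apply: exec_step; rewrite step_instr /run_instr /=.
  (* Invariant of the search: the candidates below [k] gave nonzero values and [k] is about to be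
     tested. *)
  have loop k : k <= y ->
      exec (pair_nat (cons_nat (enc f) (cons_nat
              (instr 11 (enc f) (pair_nat x 0)) K)) (pair_nat x 0))
           (pair_nat (cons_nat (enc f) (cons_nat
              (instr 11 (enc f) (pair_nat x k)) K)) (pair_nat x k)).
    elim: k => [|k IHk] hk; first exact: exec_refl.
    have [w hw] := hS _ hk.
    apply: exec_trans (IHk (ltnW hk)) _; apply: exec_trans (IHf _ _ _ hw) _.
    by apply: exec_step; rewrite step_instr /run_instr /= !pairE; exact: exec_refl.
  apply: exec_trans (loop y (leqnn y)) _; apply: exec_trans (IHf _ _ _ h0) _.
  by apply: exec_step; rewrite step_instr /run_instr /= !pairE; exact: exec_refl.
Qed.

(** * Acceptance by stages and the computable depth sequence *)

Definition halts1 (i x s : nat) : bool :=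
  iter s step (pair_nat (cons_nat i 0) x) == pair_nat 0 1.

Lemma iter_step_halt n v : iter n step (pair_nat 0 v) = pair_nat 0 v.
Proof. by elim: n => //= n ->; rewrite /step !pairE. Qed.

Lemma halts1_mono i x s s' : s <= s' -> halts1 i x s -> halts1 i x s'.
Proof.
move=> /subnK <- /eqP h; rewrite /halts1 iterD h.
by apply/eqP; exact: iter_step_halt.
Qed.

Lemma halts1_eval c x (b : bool) : eval c x b ->
  exists N, forall s, N <= s -> halts1 (enc c) x s = b.
Proof.
move=> /(@exec_eval _ _ _ 0) [n hn]; exists n => s /subnK <-.
rewrite /halts1 iterD hn iter_step_halt.
apply/eqP/idP => [/(congr1 snd_nat)|]; rewrite ?pairE; first by case: b {hn}.
by case: b {hn}.
Qed.

(* The number of inputs [pair_nat i v], [v < s], on which program [i] is seen by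
   stage [s] to halt with value 1; feeding programs their own index lets each of
   them adapt to its priority. *)
Definition accepted (i s : nat) : nat :=
  count (fun v => halts1 i (pair_nat i v) s) (iota 0 s).

Lemma accepted_mono i s s' : s <= s' -> accepted i s <= accepted i s'.
Proof.
move=> ss'; rewrite /accepted -(subnKC ss') iotaD count_cat.
apply: leq_trans (leq_addr _ _); apply: sub_count => v.
exact/halts1_mono/leq_addr.
Qed.

Lemma recursive_accepted :
  recursive (fun x => accepted (fst_nat x) (snd_nat x)).
Proof.
apply: (recursive_count (P := fun x v => halts1 (fst_nat x) (pair_nat (fst_nat x) v) (snd_nat x)));
  last by recursive.
apply: recursive_eqn; last exact: recursive_const.
apply: recursive_iter; rewrite /cons_nat; recursive.
exact: recursive_step.
Qed.

(* At stage [s] the current node of level [l] has had two children. *)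
Definition forked (e : nat -> nat) (s l : nat) : bool :=
  has (fun u =>
    has (fun t => [&& t < u, e t == l.+1, e u == l.+1 &
                   all (fun k => (t <= k) ==> (l < e k)) (iota 0 s.+1)])
        (iota 0 s.+1)) (iota 0 s.+1).

(* Requirement [i] attacks the level [accepted i s]. *)
Definition wants (e : nat -> nat) (s i : nat) : bool :=
  (i.*2.+2 <= accepted i s) && forked e s (accepted i s).

(* An attack of [i] returns to the largest depth [v <= accepted i s] such that level
   [v - 1], which it forks, is not watched by a requirement of higher priority; by
   pigeonhole [v >= accepted i s - i]. *)
Definition blocked (s i c : nat) : bool :=
  has (fun j => accepted j s == c) (iota 0 i).

Definition target (s i : nat) : nat :=
  accepted i s - find (fun k => ~~ blocked s i (accepted i s - k).-1) (iota 0 i.+1).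

(** The threshold [2 j + 2] leaves only [n] possible guards for the [n + 1] levels from [n] to
    [2 n], and it keeps the targets of attacks at least 2. *)
Definition guarded (s l : nat) : bool :=
  has (fun j => (j.*2.+2 <= l) && (accepted j s == l)) (iota 0 l).

(** Such a level gets forked by a return to depth [l.+1]; [0 < l] keeps the root the only node of
    depth 1. *)
Definition stale (e : nat -> nat) (s l : nat) : bool :=
  [&& 0 < l, ~~ forked e s l & ~~ guarded s l].

(** Attacks come first, then forking, then climbing. The search bound [e s] loses no attack: a
    requirement that wants to act has an index below the current depth. *)
Definition next_depth (e : nat -> nat) (s : nat) : nat :=
  let i := find (wants e s) (iota 0 (e s)) in
  let l := find (stale e s) (iota 0 (e s)) in
  if i < e s then target s i else if l < e s then l.+1 else (e s).+1.

(* The depths of the nodes 0, .., s, latest first. *)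
Fixpoint history (s : nat) : nat :=
  if s is s'.+1 then
    let e t := fst_nat (iter (s' - t) snd_nat (history s')) in
    pair_nat (next_depth e s') (history s')
  else pair_nat 1 0.

Definition depth (s : nat) : nat := fst_nat (history s).

Lemma history_lookup s t :
  fst_nat (iter (s - t) snd_nat (history s)) = depth (minn t s).
Proof.
elim: s => [|s IHs]; first by rewrite minn0.
case: (leqP t s) => [ts|st].
  by rewrite subSn // iterSr /= pairE IHs; congr depth; lia.
have -> : s.+1 - t = 0 by lia.
by have -> : minn t s.+1 = s.+1 by lia.
Qed.

Lemma depthS s : depth s.+1 = next_depth (fun t => depth (minn t s)) s.
Proof.
rewrite {1}/depth /= pairE; congr next_depth.
by apply: funext => t; rewrite history_lookup.
Qed.

Lemma recursive_depth : recursive depth.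
Proof.
rewrite /depth.
pose e h s t := fst_nat (iter (s - t) snd_nat h).
pose G s h := pair_nat (next_depth (e h s) s) h.
suff hG : recursive (fun x => G (fst_nat x) (snd_nat x)).
  apply: recursive_fst.
  apply: (@recursive_ext (fun x => nat_rect (fun=> nat) (pair_nat 1 0) G x)).
    by elim=> //= s ->.
  apply: (recursive_nat_rect (n := id) (g := fun _ => G)); recursive.
  apply: recursive_ext (recursive_comp hG (recursive_snd recursive_id)) => x //.
have hacc f g : recursive f -> recursive g ->
    recursive (fun x => accepted (f x) (g x)).
  move=> hf hg; apply: recursive_ext (recursive_comp recursive_accepted (recursive_pair hf hg)).
  by move=> x; rewrite !pairE.
have hp f : recursive f -> recursive (fun x => (f x).-1).
  exact: (recursive_comp recursive_predn).
have he f g h : recursive f -> recursive g -> recursive h ->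
    recursive (fun x => e (f x) (g x) (h x)).
  move=> hf hg hh; rewrite /e; apply: recursive_fst; apply: recursive_iter => //; recursive.
have hfork : recursive (fun x =>
    forked (e (fst_nat x) (fst_nat (snd_nat x))) (fst_nat (snd_nat x)) (snd_nat (snd_nat x))).
  rewrite /forked; recursive; apply: he; recursive.
have {}hfork f g h : recursive f -> recursive g -> recursive h ->
    recursive (fun x => forked (e (f x) (g x)) (g x) (h x)).
  move=> hf hg hh; apply: recursive_ext (recursive_comp hfork
    (recursive_pair hf (recursive_pair hg hh))) => x.
  by rewrite !pairE.
have htarget : recursive (fun x => target (fst_nat x) (snd_nat x)).
  rewrite /target /blocked; do ! (recursive; try first [apply: hp | apply: hacc]).
have {}htarget f g : recursive f -> recursive g ->
    recursive (fun x => target (f x) (g x)).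
  move=> hf hg; apply: recursive_ext (recursive_comp htarget (recursive_pair hf hg)).
  by move=> x; rewrite !pairE.
rewrite /G /next_depth /wants /stale /guarded.
have hd f : recursive f -> recursive (fun x => (f x).*2).
  move=> hf; apply: recursive_ext (recursive_addn hf hf) => x.
  by rewrite addnn.
do ! (recursive; try first
  [simple apply hacc | simple apply hfork | simple apply htarget
  | simple apply he | simple apply hd]).
Qed.

(** * Transitions of the depth sequence *)

Lemma mem_iota0 n k : (k \in iota 0 n) = (k < n).
Proof. by rewrite mem_iota add0n. Qed.

Lemma has_iotaP (P : pred nat) n :
  reflect (exists2 k, k < n & P k) (has P (iota 0 n)).
Proof.
by apply: (iffP hasP) => -[k]; rewrite ?mem_iota0 => h1 h2; exists k;
  rewrite ?mem_iota0.
Qed.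

Lemma forkedP e s l :
  reflect (exists t u, [/\ t < u, u <= s, e t = l.+1, e u = l.+1 &
                          forall k, t <= k <= s -> l < e k])
          (forked e s l).
Proof.
apply: (iffP (has_iotaP _ _)).
  move=> [u us /has_iotaP[t ts /and4P[tu /eqP et /eqP eu /allP h]]].
  exists t, u; split => // k /andP[tk ks].
  by apply: (implyP (h k _)) => //; rewrite mem_iota0.
move=> [t [u [tu us et eu h]]]; exists u => //.
apply/has_iotaP; exists t; first lia.
apply/and4P; split => //; try exact/eqP.
apply/allP => k; rewrite mem_iota0 => ks; apply/implyP => tk; apply: h; lia.
Qed.

(** Apart from computability and the initial depth 1, the construction is used below only through
    this trichotomy. *)
Lemma depthS_cases s :
  [\/ exists i, [/\ wants depth s i, depth s.+1 <= accepted i s,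
        accepted i s <= depth s.+1 + i &
        forall j, j < i -> accepted j s != (depth s.+1).-1],
      exists l, [/\ stale depth s l, l < depth s & depth s.+1 = l.+1] |
      [/\ forall i, ~~ wants depth s i, forall l, l < depth s -> ~~ stale depth s l &
        depth s.+1 = (depth s).+1]].
Proof.
have ds t : t <= s -> depth (minn t s) = depth t by move=> /minn_idPl ->.
have hf l : forked (fun t => depth (minn t s)) s l = forked depth s l.
  apply/forkedP/forkedP => -[t [u [tu us]]].
    rewrite !ds //; last by lia.
    move=> et eu h; exists t, u; split => // k /[dup] hk /andP[_ ks].
    by have := h k hk; rewrite ds.
  move=> et eu h; exists t, u; rewrite !ds //; last by lia.
  by split => // k /[dup] hk /andP[_ ks]; rewrite ds //; exact: h.
have hw : wants (fun t => depth (minn t s)) s =1 wants depth s.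
  by move=> i; rewrite /wants hf.
have hs : stale (fun t => depth (minn t s)) s =1 stale depth s.
  by move=> l; rewrite /stale hf.
rewrite depthS /next_depth (eq_find hw) (eq_find hs) minnn.
set i := find _ _; set l := find _ _.
have i_spec := @has_find _ (wants depth s) (iota 0 (depth s)).
rewrite size_iota in i_spec.
case: (ltnP i (depth s)) => his.
  apply: Or31; exists i.
  have wi : wants depth s i.
    have := @nth_find _ 0 (wants depth s) (iota 0 (depth s)).
    by rewrite i_spec -/i nth_iota // add0n; exact.
  have [k [hk bk et]] : exists k, [/\ k <= i, ~~ blocked s i (accepted i s - k).-1 &
      target s i = accepted i s - k].
    set P := fun k => ~~ blocked s i (accepted i s - k).-1.
    (* Pigeonhole: as [accepted i s] is at least [2 i + 2], the [i + 1] candidate levels are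
       distinct, while only [i] requirements have higher priority. *)
    have hP : has P (iota 0 i.+1).
      apply/negPn/negP => /hasPn h.
      have hl : i.*2.+2 <= accepted i s by case/andP: wi.
      pose r := [seq (accepted i s - k).-1 | k <- iota 0 i.+1].
      have ur : uniq r.
        rewrite map_inj_in_uniq ?iota_uniq // => a b; rewrite !mem_iota0; lia.
      have /(uniq_leq_size ur) : {subset r <= [seq accepted j s | j <- iota 0 i]}.
        move=> _ /mapP[k /h /negPn + ->].
        by move=> /has_iotaP[j ji /eqP <-]; apply: map_f; rewrite mem_iota0.
      by rewrite !size_map !size_iota ltnn.
    exists (find P (iota 0 i.+1)).
    have := nth_find 0 hP; move: hP; rewrite has_find size_iota => hP.
    by rewrite nth_iota // add0n.
  rewrite et; split => //; try lia.
  move=> j ji; apply: contra bk => /eqP h.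
  by apply/has_iotaP; exists j => //; rewrite h.
have nw j : ~~ wants depth s j.
  apply/negP => wj.
  have js : j < depth s.
    case/andP: wj => h1 /forkedP[t [u [tu us _ _ /(_ s)]]]; lia.
  by have /has_iotaP : exists2 k, k < depth s & wants depth s k; [exists j|rewrite i_spec -/i; lia].
have l_spec := @has_find _ (stale depth s) (iota 0 (depth s)).
rewrite size_iota in l_spec.
case: (ltnP l (depth s)) => hl.
  apply: Or32; exists l; split => //.
  have := @nth_find _ 0 (stale depth s) (iota 0 (depth s)).
  by rewrite l_spec -/l nth_iota // add0n; exact.
apply: Or33; split => // l' hl'.
apply/negP => sl.
by have /has_iotaP : exists2 k, k < depth s & stale depth s k; [exists l'|rewrite l_spec -/l; lia].
Qed.

Lemma wantsP s i : wants depth s i ->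
  i.*2.+2 <= accepted i s /\ accepted i s < depth s.
Proof.
by case/andP=> h1 /forkedP[t [u [tu us _ _ h]]]; split => //; apply: h; lia.
Qed.

Lemma depth0 : depth 0 = 1. Proof. by rewrite /depth pairE. Qed.

Lemma depthS_gt1 s : 1 < depth s.+1.
Proof.
elim: s => [|s IHs].
  case: (depthS_cases 0) => [[i [/wantsP[h1 h2] _ _ _]]|[l [/and3P[l0 _ _] _ ->]]|[_ _ ->]];
    by have := depth0; lia.
case: (depthS_cases s.+1) => [[i [/wantsP[h1 _] h2 h3 _]]|[l [/and3P[l0 _ _] _ ->]]|[_ _ ->]];
  lia.
Qed.

Lemma depth_gt0 s : 0 < depth s.
Proof. by case: s => [|s]; rewrite ?depth0 // ltnW // depthS_gt1. Qed.

Lemma depthS_leq s : depth s.+1 <= (depth s).+1.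
Proof.
case: (depthS_cases s); first by move=> [i [/wantsP[h1 h2] h3 _ _]]; lia.
  by move=> [l [_ h ->]]; lia.
by move=> [_ _ ->].
Qed.

(** * Every depth is visited finitely often *)

Lemma notin_frequently (P : nat -> Prop) :
  ~ (exists N, forall s, N <= s -> ~ P s) -> forall N, exists2 s, N <= s & P s.
Proof.
move=> h N; apply: contrapT => h'; apply: h; exists N => s Ns Ps.
by apply: h'; exists s.
Qed.

Lemma uniform_bound (P : nat -> nat -> Prop) n :
  (forall j, j < n -> exists N, forall s, N <= s -> P j s) ->
  exists N, forall s, N <= s -> forall j, j < n -> P j s.
Proof.
elim: n => [|n IHn] h; first by exists 0.
have [j jn|N1 h1] := IHn; first by apply: h; lia.
have [N2 h2] := h n (ltnSn n).
exists (maxn N1 N2) => s; rewrite geq_max => /andP[s1 s2] j.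
by rewrite ltnS leq_eqVlt => /orP[/eqP ->|jn]; [exact: h2|exact: h1].
Qed.

Lemma mono_stabilizes (f : nat -> nat) b :
  (forall s s', s <= s' -> f s <= f s') ->
  (forall N, exists2 s, N <= s & f s <= b) ->
  exists l N, forall s, N <= s -> f s = l.
Proof.
move=> fm; elim: b => [|b IHb] hb.
  exists 0, 0 => s _; have [s' /fm] := hb s; lia.
have [|h] := pselect (forall N, exists2 s, N <= s & f s <= b); first exact: IHb.
have [N hN] : exists N, forall s, N <= s -> ~ f s <= b.
  by apply: contrapT => /notin_frequently.
exists b.+1, N => s Ns; have [s' /fm h1 h2] := hb s.
by have := hN s Ns; lia.
Qed.

Definition attacks (i v s : nat) : Prop :=
  [/\ wants depth s i, depth s.+1 = v, v <= accepted i s, accepted i s <= v + i &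
      forall j, j < i -> accepted j s != v.-1].

(* After an attack of [i] has made the node of level [l] childless, it can fork again
   only by a return to level [l.+1]; as [l] is guarded by [i], only an attack of some
   [j < i] does this. *)
Lemma attacks_finite i v : exists N, forall s, N <= s -> ~ attacks i v s.
Proof.
elim/ltn_ind: i v => i IHi v; apply: contrapT => /notin_frequently inf.
(* Infinitely many attacks at depth [v] bound the nondecreasing guess by [v + i], so it
   converges. *)
have [l [N0 hl]] : exists l N, forall s, N <= s -> accepted i s = l.
  apply: (@mono_stabilizes _ (v + i)) => [s s'|N]; first exact: accepted_mono.
  by have [s Ns [_ _ _ h _]] := inf N; exists s.
have [N1 hN1] := uniform_bound (P := fun j s => ~ attacks j l.+1 s)
  (fun j ji => IHi j ji l.+1).
have [s hs [ws ds vl lv _]] := inf (maxn N0 N1).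
have [s' hs' [ws' _ _ _ _]] := inf s.+1.
move: hs; rewrite geq_max => /andP[hs0 hs1].
have il : accepted i s = l by exact: hl.
have il' : accepted i s' = l by apply: hl; lia.
have [h2 _] := wantsP ws.
case/andP: ws' => _; rewrite il' => /forkedP[t [u [tu us et eu h]]].
case: u tu us eu => [//|u] tu us eu.
have st : s.+1 < t.
  by rewrite ltnNge; apply/negP => ts; have := h s.+1; lia.
have iu : accepted i u = l by apply: hl; lia.
have hu : l < depth u by apply: h; lia.
case: (depthS_cases u); last by move=> [_ _]; lia.
  move=> [j [wj h3 h4 h5]].
  (* For [j < i] the induction hypothesis applies; [j > i] must respect the watch of [i] on level
     [l]; [i] itself returns to depth at most [l]. *)
  case: (ltngtP j i) => [ji|ij|ji].
  - by apply: (hN1 u _ j ji); [lia|rewrite -eu; split].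
  - by have := h5 i ij; rewrite iu eu /= eqxx.
  - by move: h3; rewrite ji; lia.
move=> [l' [/and3P[_ _ /has_iotaP]]] + _ el.
have -> : l' = l by lia.
by apply; exists i; rewrite ?iu ?eqxx ?andbT; lia.
Qed.

(** Once the depth stays above [v], two visits to depth [v.+1] fork level [v] for good, so it is
    never stale again. Later visits come from attacks; the threshold allows only those of
    requirements [i < v], which are finitely many. *)
Lemma depth_unbounded v : exists N, forall s, N <= s -> v < depth s.
Proof.
elim: v => [|v [N0 hN0]]; first by exists 0 => s _; exact: depth_gt0.
apply: contrapT => hinf.
have inf N : exists2 s, N <= s & depth s = v.+1.
  have [|s] := @notin_frequently (fun s => depth s = v.+1) _ (maxn N N0).
    move=> [M hM]; apply: hinf; exists (maxn M N0) => s.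
    rewrite geq_max => /andP[h1 h2]; have := hN0 s h2; have := hM s h1; lia.
  by rewrite geq_max => /andP[h1 h2]; exists s.
have [t ht et] := inf N0; have [u hu eu] := inf t.+1.
have [N1 hN1] := uniform_bound (P := fun j s => ~ attacks j v.+1 s)
  (n := v) (fun j _ => attacks_finite j v.+1).
have [[|s] hs es] := inf (maxn u.+1 N1.+1); first by move: hs; rewrite leqn0; lia.
have hv : v < depth s by apply: hN0; lia.
case: (depthS_cases s); last by move=> [_ _]; lia.
  move=> [i [wi h3 h4 h5]]; have [h6 _] := wantsP wi.
  by apply: (hN1 s _ i); [lia|lia|rewrite -es; split].
move=> [l [/and3P[_ /forkedP + _] _ el]]; apply.
have -> : l = v by lia.
by exists t, u; split => //; [lia|move=> k hk; apply: hN0; lia].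
Qed.

(** * Levels that stay forked *)

Definition forked_forever (l : nat) : Prop :=
  exists t u, [/\ t < u, depth t = l.+1, depth u = l.+1 &
                  forall k, t <= k -> l < depth k].

Lemma forked_foreverP l : forked_forever l ->
  exists N, forall s, N <= s -> forked depth s l.
Proof.
move=> [t [u [tu et eu h]]]; exists u => s us.
by apply/forkedP; exists t, u; split => // k /andP[tk _]; exact: h.
Qed.

(** Without climbs the depth would stay bounded. Climbs matter because they happen only when no
    requirement wants to act and no level below the current depth is stale. *)
Lemma climbs_frequently N : exists2 s, N <= s & depth s.+1 = (depth s).+1.
Proof.
apply: contrapT => h.
have hd s : N <= s -> depth s <= depth N.
  move=> /subnK <-; elim: (s - N) => // k IHk; apply: leq_trans IHk.
  have := depthS_leq (k + N); rewrite leq_eqVlt => /orP[/eqP e|]; last by rewrite ltnS.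
  by case: h; exists (k + N) => //; lia.
have [M hM] := depth_unbounded (depth N).
by have := hd (maxn M N) (leq_maxr _ _); have := hM _ (leq_maxl M N); lia.
Qed.

(** Otherwise [i] would want to attack at every late stage, including the climbs. *)
Lemma not_forked_forever i l N :
  (forall s, N <= s -> accepted i s = l) -> i.*2.+2 <= l -> ~ forked_forever l.
Proof.
move=> hl il /forked_foreverP[M hM].
have [s] := climbs_frequently (maxn N M); rewrite geq_max => /andP[sN sM] es.
have wi : wants depth s i by rewrite /wants hl // il hM.
case: (depthS_cases s) => [[j [/wantsP[_ h1] h2 _ _]]|[k [_ h1 h2]]|[nw _ _]].
- lia.
- lia.
- by have := nw i; rewrite wi.
Qed.

(* A level that stays unforked must be guarded, so it is the limit of [accepted j] for
   some [j] with [2 j + 2 <= l]; but no [n + 1] levels in [[n, 2 n]] can be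
   the limits of [n] sequences. *)
Lemma forked_forever_unbounded n : exists2 l, n <= l & forked_forever l.
Proof.
wlog n0 : n / 0 < n.
  by move=> /(_ n.+1 isT)[l nl fl]; exists l => //; exact: ltnW.
apply: contrapT => hn.
have lim k : exists j, j.*2.+2 <= n + k /\
    exists N, forall s, N <= s -> accepted j s = n + k.
  set l := n + k.
  have nf : ~ forked_forever l by move=> fl; apply: hn; exists l => //; exact: leq_addr.
  have [N hN] := depth_unbounded l.
  have nfs s : N <= s -> ~~ forked depth s l.
    move=> Ns; apply/negP => /forkedP[t [u [tu us et eu h]]]; apply: nf.
    exists t, u; split => // q tq.
    by case: (leqP q s) => qs; [apply: h; rewrite tq|apply: hN; lia].
  have guards M : exists2 s, M <= s & guarded s l.
    apply: contrapT => hM.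
    have [s] := climbs_frequently (maxn M N); rewrite geq_max => /andP[sM sN] es.
    have sl : stale depth s l.
      apply/and3P; split; [by rewrite /l; lia|exact: nfs|].
      by apply/negP => gl; apply: hM; exists s.
    have ls : l < depth s by exact: hN.
    case: (depthS_cases s) => [[j [/wantsP[_ h1] h2 _ _]]|[q [_ h1 h2]]|[_ ns _]].
    - lia.
    - lia.
    - by have := ns l ls; rewrite sl.
  apply: contrapT => hj.
  (* Only the finitely many [j < l] can guard [l], so one of them would do so infinitely often, and
     its monotone guess then converges to [l]. *)
  have [j jl|M hM] := @uniform_bound
      (fun j s => ~ (j.*2.+2 <= l /\ accepted j s = l)) l.
    apply: contrapT => /notin_frequently inf; apply: hj; exists j.
    have [q [N' hN']] : exists q N', forall s, N' <= s -> accepted j s = q.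
      apply: (@mono_stabilizes _ l) => [s s'|N']; first exact: accepted_mono.
      by have [s hs [_ es]] := inf N'; exists s; rewrite ?es.
    have [s hs [jl' es]] := inf N'; split => //.
    by exists N' => s' /hN' ->; rewrite -es hN'.
  have [s hs /has_iotaP[j jl /andP[h1 /eqP h2]]] := guards M.
  by apply: (hM s hs j jl); split.
have [J hJ] := choice lim.
have uJ : uniq [seq J k | k <- iota 0 n.+1].
  rewrite map_inj_in_uniq ?iota_uniq // => a b _ _ ab.
  have [[_ [Na ha]] [_ [Nb hb]]] := (hJ a, hJ b).
  have := ha (maxn Na Nb) (leq_maxl _ _).
  by rewrite ab hb ?leq_maxr //; lia.
have /(uniq_leq_size uJ) : {subset [seq J k | k <- iota 0 n.+1] <= iota 0 n}.
  move=> _ /mapP[k + ->]; rewrite !mem_iota0 => kn.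
  by have [h _] := hJ k; lia.
by rewrite size_map !size_iota ltnn.
Qed.

(** * The tree defined by the depth sequence *)

(** This is the order generated by taking as parent the latest earlier node of smaller depth. *)
Definition below (m n : nat) : bool :=
  (m <= n) && all (fun k => (m < k) ==> (depth m < depth k)) (iota 0 n.+1).

Lemma belowP m n :
  reflect (m <= n /\ forall k, m < k <= n -> depth m < depth k) (below m n).
Proof.
apply: (iffP andP) => -[mn h]; split => //.
  move=> k /andP[mk kn]; move/allP: h => /(_ k).
  by rewrite mem_iota0 => /(_ kn)/implyP; exact.
apply/allP => k; rewrite mem_iota0 => kn; apply/implyP => mk.
by apply: h; rewrite mk.
Qed.

Lemma recursive_below : recursive (fun x => below (fst_nat x) (snd_nat x)).
Proof.
have hd f : recursive f -> recursive (fun x => depth (f x)).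
  exact: (recursive_comp recursive_depth).
rewrite /below; do ! (recursive; try simple apply hd).
Qed.

Lemma below_leq m n : below m n -> m <= n. Proof. by case/andP. Qed.

Lemma below_refl n : below n n.
Proof. by apply/belowP; split => // k; lia. Qed.

Lemma below_anti m n : below m n -> below n m -> m = n.
Proof. by move=> /below_leq mn /below_leq nm; apply/eqP; rewrite eqn_leq mn. Qed.

Lemma below_depth m n : below m n -> m != n -> depth m < depth n.
Proof. by move=> /belowP[mn h] ne; apply: h; lia. Qed.

Lemma below_trans n m p : below m n -> below n p -> below m p.
Proof.
move=> mn np; have [/belowP[h1 h2] /belowP[h3 h4]] := (mn, np).
apply/belowP; split=> [|k /andP[mk kp]]; first lia.
case: (leqP k n) => kn; first by apply: h2; lia.
have := h4 k; rewrite kn kp => /(_ isT); apply: leq_ltn_trans.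
by case: (eqVneq m n) => [->//|/(below_depth mn)/ltnW].
Qed.

Lemma below_linear n m1 m2 : below m1 n -> below m2 n -> m1 <= m2 -> below m1 m2.
Proof.
move=> /belowP[h1 h2] /belowP[h3 h4] m12; apply/belowP; split=> // k hk.
by apply: h2; lia.
Qed.

Lemma below0 n : below 0 n.
Proof.
apply/belowP; split=> // -[//|k] _.
by rewrite depth0; exact: depthS_gt1.
Qed.

Definition diagonal_tree : tree.
Proof.
refine (@Tree [set: nat] below _ _ below_anti _ _ _ _) => //.
- by move=> n _; exact: below_refl.
- by move=> m n p; exact: below_trans.
- by exists 0 => // n _; exact: below0.
- move=> n _; apply: (@sub_finite_set _ _ `I_n.+1); last exact: finite_II.
  by move=> m /below_leq; rewrite /= ltnS.
- move=> n m1 m2 h1 h2; case: (leqP m1 m2) => h.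
    by left; exact: below_linear h1 h2 h.
  by right; exact: below_linear h2 h1 (ltnW h).
Defined.

Lemma computable_diagonal_tree : computable_tree diagonal_tree.
Proof.
split.
  by have [c hc] := recursive_const 1; exists c => n; split => //; apply: contra_notP.
have [c hc] := recursive_below; exists c => m n; have := hc (pair_nat m n).
by rewrite !pairE /=; case: below; split.
Qed.

(** The depth rises by at most one per stage, so no level is skipped. *)
Lemma ancestor n e : 0 < e <= depth n -> exists2 w, below w n & depth w = e.
Proof.
elim: n => [|n IHn] /andP[e0]; rewrite leq_eqVlt => /orP[/eqP ->|en].
- by exists 0 => //; exact: below_refl.
- by move: en; rewrite depth0; lia.
- by exists n.+1 => //; exact: below_refl.
have [|w /belowP[wn h] we] := IHn; first by have := depthS_leq n; lia.
exists w => //; apply/belowP; split=> [|k hk]; first lia.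
case: (ltngtP k n.+1) => [kn|nk|->]; [by apply: h; lia|lia|by rewrite we].
Qed.

(** * The unique path *)

Definition on_path (m : nat) : Prop := forall k, m <= k -> below m k.

Lemma on_pathP m : on_path m <-> forall k, m < k -> depth m < depth k.
Proof.
split=> h k mk; first by apply: below_depth; [apply: h; lia|lia].
by apply/belowP; split=> // k' /andP[mk' _]; exact: h.
Qed.

Lemma on_path_cofinal m : on_path m <-> forall N, exists2 k, N <= k & below m k.
Proof.
split=> [h N|h k mk]; first by exists (maxn m N); [lia|apply: h; lia].
have [q kq mq] := h k; apply/belowP; split=> // k' hk'.
by move/belowP: mq => [_]; apply; lia.
Qed.

Lemma on_path_down m n : below m n -> on_path n -> on_path m.
Proof.
move=> mn /on_path_cofinal h; apply/on_path_cofinal => N.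
by have [k Nk nk] := h N; exists k => //; exact: below_trans nk.
Qed.

(** The witness is the last stage of depth at most [l]. *)
Lemma on_path_level l : 0 < l -> exists2 p, on_path p & depth p = l.
Proof.
move=> l0; have [N hN] := depth_unbounded l.
elim: N hN => [|N IHN] hN; first by have := hN 0 isT; rewrite depth0; lia.
case: (ltnP l (depth N)) => hl.
  by apply: IHN => s; rewrite leq_eqVlt => /orP[/eqP <-//|]; exact: hN.
have h1 := hN N.+1 (leqnn _); have h2 := depthS_leq N.
exists N; last by lia.
by apply/on_pathP => k /hN; lia.
Qed.

Lemma chain_on_path Q : is_chain diagonal_tree Q -> infinite_set Q -> (Q `<=` on_path)%classic.
Proof.
move=> [_ lin] inf q Qq; apply/on_path_cofinal => N.
have [k [Qk Nk]] : exists k, Q k /\ maxn q N <= k.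
  apply: contrapT => h; apply: inf.
  apply: (@sub_finite_set _ _ `I_(maxn q N)); last exact: finite_II.
  by move=> k Qk /=; rewrite ltnNge; apply/negP => hk; apply: h; exists k.
exists k; first lia.
case: (lin q k Qq Qk) => //= kq; have -> : q = k by have := below_leq kq; lia.
exact: below_refl.
Qed.

Lemma infinite_on_path : infinite_set on_path.
Proof.
move=> /(@finite_seqP _)[s hs].
have [p pp ep] := @on_path_level (\max_(x <- s) depth x).+1 isT.
have ps : p \in s by have : [set` s]%classic p by rewrite -hs.
by have := @leq_bigmax_seq _ s xpredT depth p ps isT; rewrite ep ltnn.
Qed.

Lemma is_path_on_path : is_path diagonal_tree on_path.
Proof.
split; [split=> // m n hm hn|exact: infinite_on_path|].
  by case: (leqP m n) => h; [left; exact: hm|right; apply: hn; exact: ltnW].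
move=> Q cQ PQ; apply/seteqP; split=> //; apply: chain_on_path => //.
exact: sub_infinite_set PQ infinite_on_path.
Qed.

Lemma path_unique Q : is_path diagonal_tree Q -> Q = on_path.
Proof.
move=> [cQ iQ mQ]; apply/esym/mQ; first by have [] := is_path_on_path.
exact: chain_on_path.
Qed.

(** A late descendant of [n] is so deep that its ancestor of depth [(depth n).+1] lies strictly
    between. *)
Lemma finitely_branching_diagonal_tree : finitely_branching diagonal_tree.
Proof.
move=> n _; have [N hN] := depth_unbounded (depth n).+1.
apply: (@sub_finite_set _ _ `I_N); last exact: finite_II.
move=> m [[/= nm ne] nk]; rewrite ltnNge; apply/negP => /hN hm.
have [|w wm we] := @ancestor m (depth n).+1; first lia.
apply: nk; exists w; split; split=> //=; last by move=> wm'; rewrite -wm' we ltnn in hm.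
  apply: (below_linear nm wm); rewrite leqNgt; apply/negP => wn.
  have := below_depth (below_linear wm nm (ltnW wn)); lia.
by move=> nw; move: we; rewrite -nw; lia.
Qed.

Lemma type2_diagonal_tree : type2 diagonal_tree.
Proof.
split.
  move=> [n [_ inf h]].
  have pn : on_path n.
    apply/on_path_cofinal => N; apply: contrapT => hN; apply: inf.
    apply: (@sub_finite_set _ _ `I_N); last exact: finite_II.
    by move=> k nk /=; rewrite ltnNge; apply/negP => Nk; apply: hN; exists k.
  have [p pp ep] := @on_path_level (depth n).+1 isT.
  have np : n < p.
    rewrite ltnNge; apply/negP => /pp pn'.
    by case: (eqVneq p n) => [pn''|/(below_depth pn')]; [move: ep; rewrite pn''; lia|lia].
  have /h : tlt diagonal_tree n p by split; [apply: pn; lia|lia].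
  move=> fp; apply: infinite_on_path.
  apply: (@sub_finite_set _ _ (`I_p `|` cone diagonal_tree p)%classic).
    by move=> k _; case: (ltnP k p) => kp; [left|right; exact: pp].
  by rewrite finite_setU; split => //; exact: finite_II.
exists on_path; split; first exact: is_path_on_path.
by exists 0 => [k _|Q /path_unique //]; exact: below0.
Qed.

(** * Counting ancestors and locating forks *)

Definition ancestors (n : nat) : seq nat := [seq k <- iota 0 n.+1 | below k n].

Lemma mem_ancestors n k : (k \in ancestors n) = below k n.
Proof.
rewrite mem_filter mem_iota0; case: (boolP (below k n)) => // /below_leq.
by rewrite ltnS => ->.
Qed.

Lemma uniq_ancestors n : uniq (ancestors n).
Proof. exact: filter_uniq (iota_uniq _ _). Qed.

(** The depths of the ancestors are exactly 1 to [depth n]. Thus depth is an invariant of the order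
    and can be counted in any copy of the tree. *)
Lemma size_ancestors n : size (ancestors n) = depth n.
Proof.
rewrite -(size_map depth) -[RHS](size_iota 1); apply/perm_size/uniq_perm.
- rewrite map_inj_in_uniq ?uniq_ancestors // => a b; rewrite !mem_ancestors => an bn ab.
  case: (ltngtP a b) => // h.
    by have := below_depth (below_linear an bn (ltnW h)); lia.
  by have := below_depth (below_linear bn an (ltnW h)); lia.
- exact: iota_uniq.
move=> e; rewrite mem_iota; apply/mapP/idP => [[k + ->]|he].
  rewrite mem_ancestors => kn; have := depth_gt0 k.
  by case: (eqVneq k n) => [->|/(below_depth kn)]; lia.
have [|w wn we] := @ancestor n e; first lia.
by exists w; rewrite ?mem_ancestors.
Qed.

(** The node [u] is the greatest common ancestor; its children towards [y] and [z] differ, and [u]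
    is never left because it is below [y]. *)
Lemma fork_of_path_node y z :
  on_path y -> ~~ below y z -> ~~ below z y ->
  exists2 u, (forall k, below k u = below k y && below k z) & forked_forever (depth u).
Proof.
move=> py yz zy.
pose common k := below k y && below k z.
have c0 : exists k, common k by exists 0; rewrite /common !below0.
have cy k : common k -> k <= y by case/andP=> /below_leq.
case: (ex_maxnP c0 cy) => u /andP[uy uz] umax.
have lub k : below k u = common k.
  apply/idP/idP => [ku|ck]; first by rewrite /common !(below_trans ku).
  by have /andP[ky _] := ck; exact: below_linear ky uy (umax _ ck).
exists u => //.
have child x : below u x -> u != x -> exists w, [/\ below w x, u < w & depth w = (depth u).+1].
  move=> ux ne; have [|w wx we] := @ancestor x (depth u).+1.
    by have := below_depth ux ne; lia.
  exists w; split => //; rewrite ltnNge; apply/negP => wu.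
  have wu' := below_linear wx ux wu.
  by case: (eqVneq w u) => [e|/(below_depth wu')]; [move: we; rewrite e|]; lia.
have [|a [ay ua ea]] := child y uy; first by apply: contraNneq yz => <-.
have [|b [bz ub eb]] := child z uz; first by apply: contraNneq zy => <-.
have ab : a != b.
  apply/negP => /eqP e; have /umax : common a by rewrite /common ay e.
  by rewrite leqNgt ua.
have /on_pathP pu := on_path_down uy py.
case: (ltngtP a b) ab => // ab _; [exists a, b|exists b, a]; split => // k hk;
  by apply: pu; lia.
Qed.

(** The child [t] is left when [u] appears, so it is off the path and serves as [z]; [y] is the path
    node of level [l.+1]. *)
Lemma split_at_fork l : 0 < l -> forked_forever l ->
  exists w y z, [/\ on_path w, depth w = l, on_path y, below w y /\ below w z &
                    ~~ below y z /\ ~~ below z y].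
Proof.
move=> l0 [t [u [tu et eu h]]].
have [w pw ew] := on_path_level l0; have [y py ey] := on_path_level (ltn0Sn l).
have wt : w < t by rewrite ltnNge; apply/negP => /h; lia.
have ty : t < y.
  case: (ltnP t y) => // yt; move/on_pathP: py => /(_ u); lia.
exists w, y, t; split => //; first by split; apply: pw; lia.
by split; apply/negP => /[dup] /below_leq h1 /below_depth; lia.
Qed.

(** * Self-embeddings push forks upwards *)

Section Embedding.
Variable f : nat -> nat.
Hypothesis fE : forall m n, below (f m) (f n) = below m n.

Lemma emb_inj : injective f.
Proof. by move=> m n e; apply: below_anti; rewrite -fE e below_refl. Qed.

Lemma emb_unbounded N : exists K, forall k, K <= k -> N <= f k.
Proof.
elim: N => [|N [K hK]]; first by exists 0.
have [[k0 e0]|h] := pselect (exists k0, f k0 = N).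
  exists (maxn K k0.+1) => k; rewrite geq_max => /andP[/hK h1 h2].
  rewrite ltn_neqAle h1 andbT; apply/negP => /eqP; rewrite -e0 => /emb_inj; lia.
exists K => k /hK h1; rewrite ltn_neqAle h1 andbT.
by apply/negP => /eqP e; apply: h; exists k.
Qed.

Lemma emb_on_path x : on_path x -> on_path (f x).
Proof.
move=> px; apply/on_path_cofinal => N; have [K hK] := emb_unbounded N.
by exists (f (maxn x K)); [apply: hK; lia|rewrite fE; apply: px; lia].
Qed.

Lemma emb_depth x : depth x <= depth (f x).
Proof.
rewrite -!size_ancestors -(size_map f); apply: uniq_leq_size.
  by rewrite map_inj_uniq ?uniq_ancestors //; exact: emb_inj.
by move=> _ /mapP[k + ->]; rewrite !mem_ancestors fE.
Qed.

(** Nodes of the path are comparable, and [f] cannot lower the depth. *)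
Lemma emb_moves x : on_path x -> f x != x -> below x (f x).
Proof.
move=> px ne; have pf := emb_on_path px.
case: (leqP x (f x)) => h; first exact: px.
by have := below_depth (pf _ (ltnW h)) ne; have := emb_depth x; lia.
Qed.

Lemma emb_iter m x y : below (iter m f x) (iter m f y) = below x y.
Proof. by elim: m => //= m IHm; rewrite fE. Qed.

Lemma iter_on_path m x : on_path x -> on_path (iter m f x).
Proof. by move=> px; elim: m => //= m; exact: emb_on_path. Qed.

Lemma iter_moves m x : on_path x -> f x != x ->
  below (iter m f x) (iter m.+1 f x) /\ iter m f x != iter m.+1 f x.
Proof.
move=> px ne; split; first by rewrite iterSr emb_iter; exact: emb_moves.
elim: m => [|m]; first by rewrite eq_sym.
by apply: contra => /eqP /emb_inj /eqP.
Qed.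

Lemma depth_iter m x : on_path x -> f x != x -> m < depth (iter m f x).
Proof.
move=> px ne; elim: m => [|m IHm]; first exact: depth_gt0.
have [le lt] := iter_moves m px ne.
exact: leq_ltn_trans IHm (below_depth le lt).
Qed.

(** If [w] were fixed, the whole orbit of [x] would stay below [w], although its depths are
    unbounded. *)
Lemma emb_moves_up x w : on_path w -> below x w -> f x != x -> f w != w.
Proof.
move=> pw xw ne; apply/negP => /eqP fw.
have xjw j : below (iter j f x) w by elim: j => //= j; rewrite -{2}fw fE.
have := depth_iter (depth w) (on_path_down xw pw) ne.
by case: (eqVneq (iter (depth w) f x) w) => [->|/(below_depth (xjw _))]; lia.
Qed.

Lemma emb_moves_path n : (forall m, f m != n) -> exists2 x, on_path x & f x != x.
Proof.
move=> hn; apply: contrapT => h.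
have fixed x : on_path x -> f x = x.
  by move=> px; apply/eqP/negPn/negP => ne; apply: h; exists x.
have [N hN] := depth_unbounded (depth n); have [p pp ep] := on_path_level (ltn0Sn (depth n)).
(* [f] fixes [p], so it permutes the nodes that are not above [p]. *)
have np : n < p.
  rewrite ltnNge; apply/negP => /pp pn.
  by case: (eqVneq p n) => [e|/(below_depth pn)]; [move: ep; rewrite e|]; lia.
have abovep k : below p k = (p <= k).
  by apply/idP/idP; [exact: below_leq|exact: pp].
have sub : {subset [seq f k | k <- iota 0 p] <= iota 0 p}.
  move=> _ /mapP[k + ->]; rewrite !mem_iota0 ltnNge => kp.
  by rewrite ltnNge -abovep -{1}(fixed p pp) fE abovep.
have /uniq_min_size : uniq [seq f k | k <- iota 0 p].
  by rewrite map_inj_uniq ?iota_uniq //; exact: emb_inj.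
move=> /(_ _ sub); rewrite size_map leqnn => /(_ isT)[_ /(_ n)].
by rewrite mem_iota0 np => /mapP[k _ e]; have := hn k; rewrite -e eqxx.
Qed.

(* The order of the quantifiers matters: [y] and [z] do not depend on [m], so that a
   program can compute the prongs of the fork from [m]. *)
Lemma high_forks n : (forall m, f m != n) ->
  exists y z, forall m, exists u, [/\ m < depth u, forked_forever (depth u) &
    forall k, below k u = below k (iter m f y) && below k (iter m f z)].
Proof.
move=> /emb_moves_path[x px ne].
have [l xl fl] := forked_forever_unbounded (depth x).
have l0 : 0 < l by have := depth_gt0 x; lia.
have [w [y [z [pw ew py [wy wz] [yz zy]]]]] := split_at_fork l0 fl.
have xw : below x w.
  apply: px; rewrite leqNgt; apply/negP => wx.
  by have := below_depth (pw _ (ltnW wx)); lia.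
have new := emb_moves_up pw xw ne.
exists y, z => m.
have [||u hu fu] := @fork_of_path_node (iter m f y) (iter m f z) (iter_on_path py).
- by rewrite emb_iter.
- by rewrite emb_iter.
exists u; split => //.
have wu : below (iter m f w) u by rewrite hu !emb_iter wy.
have := depth_iter m pw new.
by case: (eqVneq (iter m f w) u) => [->//|/(below_depth wu)]; lia.
Qed.

End Embedding.

(** * The diagonal argument *)

Lemma accepted_limit c (r : seq nat) : uniq r ->
  (forall v, eval c (pair_nat (enc c) v) (v \in r)) ->
  exists N, forall s, N <= s -> accepted (enc c) s = size r.
Proof.
move=> ur hc.
have halts v : exists N, forall s, N <= s -> halts1 (enc c) (pair_nat (enc c) v) s = (v \in r).
  exact: halts1_eval.
have sound v s : halts1 (enc c) (pair_nat (enc c) v) s -> v \in r.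
  move=> h; have [N hN] := halts v; rewrite -(hN _ (leq_maxl N s)).
  exact: halts1_mono (leq_maxr _ _) h.
have [M hM] := choice halts.
have [N hN] : exists N, forall v, v \in r ->
    v < N /\ forall s, N <= s -> halts1 (enc c) (pair_nat (enc c) v) s.
  exists (\max_(v <- r) maxn v.+1 (M v)) => v vr.
  have := @leq_bigmax_seq _ r xpredT (fun v => maxn v.+1 (M v)) v vr isT.
  rewrite geq_max => /andP[h1 h2]; split => // s hs.
  by rewrite hM //; exact: leq_trans hs.
exists N => s Ns; rewrite /accepted -size_filter; apply/perm_size/uniq_perm => //.
  exact: filter_uniq (iota_uniq _ _).
move=> v; rewrite mem_filter mem_iota0; apply/andP/idP => [[/sound]//|vr].
by have [h1 h2] := hN v vr; split; [exact: h2|lia].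
Qed.

Theorem theorem4p5 :
  exists S : tree,
    [/\ computable_tree S,
        finitely_branching S,
        exists! P : set nat, is_path S P,
        type2 S &
        forall T : tree, computable_tree T -> isomorphic S T ->
          ~ exists f : nat -> nat,
              nontrivial_self_embedding T f /\ computable_on (nodes T) f].
Proof.
exists diagonal_tree; split.
- exact: computable_diagonal_tree.
- exact: finitely_branching_diagonal_tree.
- by exists on_path; split; [exact: is_path_on_path|move=> Q /path_unique].
- exact: type2_diagonal_tree.
move=> T [_ [t ht]] [phi [[phiT phi_inj phiE] phi_onto]] [f [[[fT f_inj fE] f_nonto] [cf hcf]]].
(* The map [g] is [f] transported to the diagonal tree; it need not be computable. *)
have /choice[g hg] : forall n, exists m, phi m = f (phi n).
  by move=> n; have [m _ e] := phi_onto _ (fT _ (phiT n I)); exists m.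
have phi_below m n : below m n <-> tle T (phi m) (phi n) by exact: phiE.
have gE m n : below (g m) (g n) = below m n.
  apply/idP/idP => [/phi_below|/phi_below h].
    by rewrite !hg => /(fE _ _ (phiT _ I) (phiT _ I))/phi_below.
  by apply/phi_below; rewrite !hg; apply/(fE _ _ (phiT _ I) (phiT _ I)).
have [n hn] : exists n, forall m, g m != n.
  apply: contrapT => h; apply: f_nonto => y Ty.
  have [n _ <-] := phi_onto _ Ty.
  have [m /eqP e] : exists m, g m == n.
    by apply: contrapT => h'; apply: h; exists n => m; apply/negP => e; apply: h'; exists m.
  by exists (phi m); [exact: phiT|rewrite -hg e].
have [y [z forks]] := high_forks gE hn.
have iter_g m x : phi (iter m g x) = iter m f (phi x).
  by elim: m => //= m <-.
(* Orbits stay inside the nodes of [T], where [cf] computes [f]; of [phi], only the constant [phi x]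
   enters the program. *)
have recursive_orbit x : recursive (fun m => iter m f (phi x)).
  have [[ca ha] [ci hi]] := (recursive_const (phi x), recursive_id).
  exists (CComp (CPrec ca (CComp cf (CComp CSnd CSnd))) (CPair CZero ci)) => m.
  exists (pair_nat 0 m); first by exists 0, m; split => //; exact: hi.
  rewrite /= snd_pair fst_pair; elim: m => [|m IHm]; first exact: ha.
  eexists; first exact: IHm.
  exists (iter m f (phi x)); last by rewrite iterS -iter_g; apply: hcf; exact: phiT.
  by eexists; [reflexivity|rewrite !pairE].
have [chi [hchi chiE]] : exists chi : nat -> bool, recursive chi /\
    forall a b, tle T a b <-> chi (pair_nat a b).
  exists (fun x => `[< tle T (fst_nat x) (snd_nat x) >]); split.
    exists t => x; have [h1 h2] := ht (fst_nat x) (snd_nat x).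
    by rewrite pair_fst_snd in h1 h2; case: asboolP.
  by move=> a b; rewrite !pairE asboolE.
have chi_below k x : chi (pair_nat (phi k) (phi x)) = below k x.
  by apply/idP/idP => [/chiE/phi_below|/phi_below/chiE].
(* The first component of the input is the program's own index [i]; iterating [2 i + 2] times lifts
   the fork above the threshold of requirement [i]. *)
pose acc w := chi (pair_nat (snd_nat w) (iter (fst_nat w).*2.+2 f (phi y))) &&
              chi (pair_nat (snd_nat w) (iter (fst_nat w).*2.+2 f (phi z))).
have [c hc] : recursive acc.
  have hm : recursive (fun w => (fst_nat w).*2.+2).
    apply: (@recursive_ext (fun w => (fst_nat w + fst_nat w).+2)); last by recursive.
    by move=> w; rewrite addnn.
  have [hy hz] := (recursive_comp (recursive_orbit y) hm, recursive_comp (recursive_orbit z) hm).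
  by apply: recursive_andb; apply: (recursive_comp hchi); recursive.
have [u [mu fu hu]] := forks (enc c).*2.+2.
have [||N hN] := @accepted_limit c [seq phi k | k <- ancestors u].
- rewrite map_inj_in_uniq ?uniq_ancestors // => a b _ _; apply: phi_inj; exact: mem_set.
- move=> v; have -> : (v \in [seq phi k | k <- ancestors u]) = acc (pair_nat (enc c) v).
    rewrite /acc !pairE -!iter_g;
    apply/mapP/idP => [[k + ->]|/[dup] + /andP[/chiE/tle_nodes[Tv _] _]].
      by rewrite mem_ancestors hu !chi_below.
    (* Accepted inputs are nodes of [T], hence images under [phi]. *)
    have [k _ <-] := phi_onto _ Tv; rewrite !chi_below -hu => ku.
    by exists k; rewrite ?mem_ancestors.
  exact: hc.
rewrite size_map size_ancestors in hN.
by apply: not_forked_forever hN _ fu; exact: ltnW.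
Qed.
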